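(* Let $d\ge1$ and let $p(\lambda)=1+\sum_{j=1}^d a_j\lambda^j=\prod_{j=1}^d(1+b_j\lambda)$ be a scalar polynomial, with $b_1,\dots,b_d\in\mathbb{C}$ satisfying $$\operatorname{var}(\operatorname{Im} b_1,\dots,\operatorname{Im} b_d)\le (d-1)\bigl(\operatorname{mean}(\operatorname{Im} b_1,\dots,\operatorname{Im} b_d)\bigr)^2 .$$ Then for every $A\in\mathbb{C}^{n\times n}$, $$\|p(A)\|\le\exp\Bigl(\|A\|\sum_{j=1}^d|b_j|\Bigr)\le\exp\Bigl(\|A\|\sqrt{d\,(|a_1|^2-2\operatorname{Re}a_2)}\Bigr),$$ and $$\|p(A)\|\le\exp\Bigl(|a_1|\,\|A\|+\tfrac12\bigl(|a_1|^2-2\operatorname{Re}a_2\bigr)\|A\|^2\Bigr).$$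
   Context: For real $x_1,\dots,x_d$: $\operatorname{mean}(x_1,\dots,x_d)=\frac1d\sum_{j=1}^d x_j=:m$ and $\operatorname{var}(x_1,\dots,x_d)=\frac1d\sum_{j=1}^d(x_j-m)^2$; with these conventions the hypothesis is equivalent to $\sum_{1\le j<k\le d}\operatorname{Im}b_j\operatorname{Im}b_k\ge 0$. $\|\cdot\|$ is the operator norm on $\mathbb{C}^{n\times n}$ induced by the Euclidean norm. $a_1,a_2$ are the coefficients of $\lambda,\lambda^2$ in $p$ (so $a_2=0$ if $d=1$). *)

(* Defs.v *)
From mathcomp Require Import all_boot all_order all_algebra.
From mathcomp Require Import complex.
From mathcomp Require Import classical_sets reals.

Set Implicit Arguments.
Unset Strict Implicit.
Unset Printing Implicit Defensive.

Import Order.TTheory GRing.Theory Num.Theory.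

Local Open Scope complex_scope.
Local Open Scope classical_set_scope.
Local Open Scope ring_scope.

Section Definitions.
Variable R : realType.

Definition mean (d : nat) (x : 'I_d -> R) : R :=
  d%:R^-1 * \sum_(j < d) x j.

(* Population variance: the normalisation is 1/d, not 1/(d-1). *)
Definition var (d : nat) (x : 'I_d -> R) : R :=
  d%:R^-1 * \sum_(j < d) (x j - mean x) ^+ 2.

(* The library norm `|z| on R[i] takes values in R[i]; Normc.normc is the
   same modulus, valued in R. *)
Definition cmod (z : R[i]) : R := Normc.normc z.

Definition enorm (n : nat) (x : 'cV[R[i]]_n) : R :=
  Num.sqrt (\sum_(k < n) cmod (x k 0) ^+ 2).

(* The set is nonempty and bounded above, so sup is a genuine supremum. *)
Definition opnorm (n : nat) (A : 'M[R[i]]_n) : R :=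
  sup [set enorm (A *m x) | x in [set x : 'cV[R[i]]_n | enorm x <= 1]].

End Definitions.

(* Main.v *)
Require Import Defs.
From mathcomp Require Import all_boot all_order all_algebra.
From mathcomp Require Import complex.
From mathcomp Require Import classical_sets reals sequences exp.
From mathcomp Require Import cyclic separable cyclotomic ring lra.
From mathcomp Require Import filter topology normedtype.

(** The three bounds follow from von Neumann's inequality: a matrix polynomial
    satisfies [|p(A)| <= M r] as soon as [|p(z)| <= M r] on the circle of
    radius [r = |A|].  It reduces everything to one complex number [z], where

    - [|1 + b z| <= 1 + |b| |z| <= exp (|b| |z|)] gives the first bound;
    - [|1 + w|^2 = 1 + 2 Re w + |w|^2 <= exp (2 Re w + |w|^2)], multiplied over
      the factors [w = b_j z], gives
      [|p(z)| <= exp (Re (a_1 z) + 1/2 sum |b_j|^2 |z|^2)].  Only the sum of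
      the real parts enters, so the linear term is [|a_1| |z|] and not
      [sum |b_j| |z|]; estimating the operator factors one by one would lose
      this, and it is why von Neumann's inequality is needed.

    The quantity [Q = |a_1|^2 - 2 Re a_2] dominates [sum |b_j|^2]
    ([sum_cmod_sqr_le]): with [b_j = x_j + i y_j] it equals
    [2 (sum y_j)^2 + sum x_j^2 - sum y_j^2], and the variance hypothesis says
    exactly that [sum y_j^2 <= (sum y_j)^2].  The middle bound is then the
    Cauchy-Schwarz inequality.

    Von Neumann's inequality itself is proved by a finite Fourier transform.
    For a contraction [T], the defect [D u = |u|^2 - |T u|^2] is a nonnegative
    quadratic form whose sum along an orbit telescopes
    ([sum_defect_orbit]).  Make the orbit segment [T^k x], [k < N], periodic.
    Applying [p] to the shift multiplies each Fourier coefficient by a value of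
    [p] at an [N]-th root of unity ([dft_filter]), hence by at most [M] in
    modulus; Parseval's identity for [D] turns this into
    [sum D (T^k p(T) x) <= M^2 sum D (T^k x)], where the left sum ranges over
    the [k] for which the periodisation has not wrapped around.  Both sides
    telescope, and if [|T| <= q < 1] the boundary term at infinity vanishes
    ([von_neumann_strict]).  The strict inequality is then removed by rescaling
    [A] by some [r > |A|] and letting [r] decrease to [|A|]
    ([von_neumann_growth]). *)

Import Order.TTheory GRing.Theory Num.Theory.
Import numFieldNormedType.Exports.

Local Open Scope complex_scope.
Local Open Scope ring_scope.

Set Implicit Arguments.
Unset Strict Implicit.
Unset Printing Implicit Defensive.

(** * The complex modulus *)

Section Modulus.
Variable R : realType.
Implicit Types z w : R[i].

Lemma cmodE z : (cmod z)%:C = `|z|.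
Proof. by case: z. Qed.

Lemma sqr_cmod z : cmod z ^+ 2 = complex.Re z ^+ 2 + complex.Im z ^+ 2.
Proof. by case: z => x y; rewrite /cmod /= sqr_sqrtr ?addr_ge0 ?sqr_ge0. Qed.

Lemma cmod_ge0 z : 0 <= cmod z.
Proof. by case: z => x y; exact: sqrtr_ge0. Qed.

Lemma cmodM z w : cmod (z * w) = cmod z * cmod w.
Proof. exact: Normc.normcM. Qed.

Lemma cmod1 : cmod (1 : R[i]) = 1.
Proof. exact: Normc.normc1. Qed.

Lemma cmod0 : cmod (0 : R[i]) = 0.
Proof. exact: Normc.normc0. Qed.

Lemma cmodX z k : cmod (z ^+ k) = cmod z ^+ k.
Proof. by elim: k => [|k IH]; rewrite ?expr0 ?cmod1 // !exprS cmodM IH. Qed.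

Lemma cmod_real (r : R) : 0 <= r -> cmod r%:C = r.
Proof. by move=> r0; rewrite /cmod /= expr0n addr0 sqrtr_sqr ger0_norm. Qed.

Lemma ler_cmodD z w : cmod (z + w) <= cmod z + cmod w.
Proof. exact: le_normcD. Qed.

Lemma ler_cmod_sum (I : Type) (s : seq I) (F : I -> R[i]) :
  cmod (\sum_(i <- s) F i) <= \sum_(i <- s) cmod (F i).
Proof.
elim/big_ind2: _ => [|x a y c xa yc|//]; first by rewrite cmod0.
by apply: le_trans (ler_cmodD _ _) _; apply: lerD.
Qed.

Lemma ler_Re_cmod z : complex.Re z <= cmod z.
Proof.
apply: le_trans (ler_norm _) _.
rewrite -(@ler_pXn2r _ 2) ?nnegrE ?cmod_ge0 ?normr_ge0 // real_normK ?num_real //.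
by rewrite sqr_cmod lerDl sqr_ge0.
Qed.

Lemma cmod_unity_root N w : (0 < N)%N -> w ^+ N = 1 -> cmod w = 1.
Proof.
move=> N0 /(congr1 (@cmod R)); rewrite cmodX cmod1 => /eqP.
by rewrite pexpr_eq1 ?cmod_ge0 -?lt0n // => /eqP.
Qed.

Lemma conj_unit_circle w : cmod w = 1 -> w^*%C = w^-1.
Proof. by move=> w1; rewrite invc_norm -cmodE w1 expr1n invr1 mul1r. Qed.

End Modulus.

(** * Roots of unity and the discrete Fourier transform *)

Section Fourier.
Variable R : realType.

(** [X^N - 1] splits over an algebraically closed field and is separable, so it
    has [N] distinct roots, which is enough to find a primitive one. *)
Lemma prim_root_exists N : (0 < N)%N -> exists w : R[i], N.-primitive_root w.
Proof.
move=> N0; pose p : {poly R[i]} := 'X^N - 1.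
have [r Dp] := closed_field_poly_normal p.
rewrite (monicP _) ?monicXnsubC // scale1r in Dp.
have rn1: all N.-unity_root r by apply/allP=> z; rewrite -root_prod_XsubC -Dp.
have sz_r: (N < (size r).+1)%N.
  by rewrite -(size_prod_XsubC r id) -Dp size_XnsubC.
have [|z] := hasP (has_prim_root N0 rn1 _ sz_r); last by exists z.
by rewrite -separable_prod_XsubC -Dp separable_Xn_sub_1 // pnatr_eq0 -lt0n.
Qed.

Lemma sum_expr_unity_root (F : fieldType) N (z : F) :
  z ^+ N = 1 -> \sum_(i < N) z ^+ i = if z == 1 then N%:R else 0.
Proof.
move=> zN; case: eqP => [->|/eqP z1].
  by under eq_bigr do rewrite expr1n; rewrite sumr_const card_ord.
have /eqP : (z - 1) * \sum_(i < N) z ^+ i = 0 by rewrite -subrX1 zN subrr.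
by rewrite mulf_eq0 subr_eq0 (negPf z1) => /eqP.
Qed.

(** Expanding the squares gives the terms [u_k * conj u_l] weighted by
    [sum_i (w^(k - l))^i]; this geometric sum of an [N]-th root of unity
    vanishes unless [k = l]. *)
Lemma parseval N (w : R[i]) (u : nat -> R[i]) : N.-primitive_root w ->
  \sum_(i < N) cmod (\sum_(k < N) w ^+ (i * k) * u k) ^+ 2
    = N%:R * \sum_(k < N) cmod (u k) ^+ 2.
Proof.
move=> prw; have N0 := prim_order_gt0 prw.
have w1 : cmod w = 1 by apply: cmod_unity_root N0 (prim_expr_order prw).
have wn0 : w != 0.
  by apply: contra_eq_neq w1 => ->; rewrite cmod0 eq_sym oner_eq0.
have sqC (z : R[i]) : (cmod z ^+ 2)%:C = z * z^*%C.
  by rewrite rmorphXn /= cmodE sqr_normc.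
apply: (@complexI R); rewrite rmorphM rmorph_nat !rmorph_sum /=.
under eq_bigr do rewrite sqC rmorph_sum big_distrlr /=.
rewrite exchange_big mulr_sumr; apply: eq_bigr => k _ /=.
rewrite exchange_big /= (bigD1 k) //= [X in _ + X]big1 ?addr0 => [|l lk].
  rewrite sqC; under eq_bigr => i _.
    rewrite rmorphM rmorphXn /= conj_unit_circle //.
    rewrite mulrACA exprVn divff ?expf_neq0 // mul1r; over.
  by rewrite sumr_const card_ord mulr_natl.
under eq_bigr => i _.
  rewrite rmorphM rmorphXn /= conj_unit_circle // mulrACA.
  rewrite mulnC [(i * l)%N]mulnC !exprM -exprMn; over.
rewrite -mulr_suml sum_expr_unity_root; last first.
  by rewrite exprMn -!exprM ![(_ * N)%N]mulnC !exprM exprVn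
       (prim_expr_order prw) invr1 !expr1n mulr1.
rewrite exprVn -(inj_eq (mulIf (expf_neq0 l wn0))) divfK ?expf_neq0 // mul1r.
rewrite (eq_prim_root_expr prw) /eqn !modn_small ?ltn_ord //.
by rewrite eq_sym (inj_eq val_inj) (negPf lk) mul0r.
Qed.

End Fourier.

(** * The Euclidean norm *)

Section Euclidean.
Variables (R : realType) (n : nat).
Implicit Types x : 'cV[R[i]]_n.

Lemma enorm_ge0 x : 0 <= enorm x.
Proof. exact: sqrtr_ge0. Qed.

Lemma sqr_enorm x : enorm x ^+ 2 = \sum_(k < n) cmod (x k 0) ^+ 2.
Proof. by rewrite sqr_sqrtr // sumr_ge0 // => k _; rewrite sqr_ge0. Qed.

Lemma enormZ c x : enorm (c *: x) = cmod c * enorm x.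
Proof.
apply/eqP; rewrite -(@eqrXn2 _ 2) ?mulr_ge0 ?enorm_ge0 ?cmod_ge0 //; apply/eqP.
rewrite exprMn !sqr_enorm mulr_sumr; apply: eq_bigr => k _.
by rewrite mxE cmodM exprMn.
Qed.

Lemma enorm0 : enorm (0 : 'cV[R[i]]_n) = 0.
Proof. by rewrite -(scale0r (0 : 'cV[R[i]]_n)) enormZ cmod0 mul0r. Qed.

Lemma enorm_eq0 x : enorm x = 0 -> x = 0.
Proof.
move=> x0; have /eqP : \sum_(k < n) cmod (x k 0) ^+ 2 = 0.
  by rewrite -sqr_enorm x0 expr0n.
rewrite psumr_eq0 => [/allP h|k _]; last exact: sqr_ge0.
apply/matrixP => k j; rewrite ord1 mxE.
have := h k (mem_index_enum k); rewrite /= expf_eq0 /= => /eqP.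
exact: Normc.eq0_normc.
Qed.

Lemma parseval_enorm N (w : R[i]) (u : nat -> 'cV[R[i]]_n) :
  N.-primitive_root w ->
  \sum_(i < N) enorm (\sum_(k < N) w ^+ (i * k) *: u k) ^+ 2
    = N%:R * \sum_(k < N) enorm (u k) ^+ 2.
Proof.
move=> prw; under eq_bigr do rewrite sqr_enorm.
under [in RHS]eq_bigr do rewrite sqr_enorm.
rewrite exchange_big [in RHS]exchange_big mulr_sumr /=; apply: eq_bigr => j _.
rewrite -(parseval (fun k => u k j 0) prw); apply: eq_bigr => i _.
by rewrite summxE; under eq_bigr do rewrite mxE.
Qed.

End Euclidean.

(** * Von Neumann's inequality for strict contractions *)

Section Periodic.
Variable V : nmodType.

Lemma sum_periodic_shift N (f : nat -> V) m :
  (forall k, f (k + N)%N = f k) ->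
  \sum_(k < N) f (k + m)%N = \sum_(k < N) f k.
Proof.
move=> fN; elim: m => [|m IH]; first by under eq_bigr do rewrite addn0.
rewrite -{}IH; case: N fN => [|N] fN; first by rewrite !big_ord0.
rewrite big_ord_recr big_ord_recl /= addrC; congr (_ + _).
  by rewrite -[in RHS]fN /= add0n [in LHS]addnC addSnnS.
by apply: eq_bigr => i _; rewrite /bump /= add1n addSnnS.
Qed.

End Periodic.

Section VonNeumann.
Local Open Scope classical_set_scope.
Local Open Scope ring_scope.
Variable R : realType.

(** The Fourier transform diagonalises the shift of [N]-periodic sequences:
    shifting by one multiplies the [i]-th coefficient by [w^-i], so the
    polynomial [p] in the shift multiplies it by [p(w^-i)]. *)
Lemma dft_filter (V : lmodType R[i]) N (w : R[i]) (p : {poly R[i]})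
    (u : nat -> V) i :
  w ^+ N = 1 -> w != 0 -> (forall k, u (k + N)%N = u k) ->
  \sum_(k < N) w ^+ (i * k) *: (\sum_(m < size p) p`_m *: u (k + m)%N)
    = p.[w ^- i] *: \sum_(k < N) w ^+ (i * k) *: u k.
Proof.
move=> wN w0 uN; under eq_bigr do rewrite scaler_sumr.
rewrite exchange_big /= horner_coef scaler_suml; apply: eq_bigr => m _.
have /(sum_periodic_shift m) <- : forall k,
    w ^+ (i * (k + N)) *: u (k + N)%N = w ^+ (i * k) *: u k.
  by move=> k; rewrite uN mulnDr exprD [(i * N)%N]mulnC [w ^+ (N * i)]exprM wN expr1n mulr1.
rewrite scaler_sumr; apply: eq_bigr => k _; rewrite !scalerA; congr (_ *: _).
by rewrite mulnDr exprD exprVn -exprM mulrC mulrA mulrAC mulfVK ?expf_neq0.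
Qed.

Lemma horner_mx_sum n (A : 'M[R[i]]_n.+1) (p : {poly R[i]}) :
  horner_mx A p = \sum_(m < size p) p`_m *: A ^+ m.
Proof.
rewrite -[in LHS](coefK p) poly_def rmorph_sum; apply: eq_bigr => m _.
by rewrite /= horner_mxZ rmorphXn /= horner_mx_X.
Qed.

Section Contraction.
Variables (n : nat) (T : 'M[R[i]]_n.+1).
Hypothesis T_contr : forall x : 'cV_n.+1, enorm (T *m x) <= enorm x.

Definition defect (x : 'cV[R[i]]_n.+1) := enorm x ^+ 2 - enorm (T *m x) ^+ 2.

Lemma defect_ge0 x : 0 <= defect x.
Proof. by rewrite subr_ge0 ler_pXn2r ?nnegrE ?enorm_ge0. Qed.

Lemma defectZ c x : defect (c *: x) = cmod c ^+ 2 * defect x.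
Proof. by rewrite /defect -scalemxAr !enormZ !exprMn mulrBr. Qed.

Lemma sum_defect_orbit N x :
  \sum_(k < N) defect (T ^+ k *m x) = enorm x ^+ 2 - enorm (T ^+ N *m x) ^+ 2.
Proof.
under eq_bigr do rewrite /defect mulmxA -[T *m _]/(T * _) -exprS.
rewrite -(big_mkord xpredT (fun k => enorm (T ^+ k *m x) ^+ 2
  - enorm (T ^+ k.+1 *m x) ^+ 2)).
rewrite -[LHS]opprK -sumrN; under eq_bigr do rewrite opprB.
by rewrite telescope_sumr // expr0 mul1mx opprB.
Qed.

(** The defect is a difference of two squared norms of vectors that depend
    linearly on [u], so Parseval's identity passes to it. *)
Lemma parseval_defect N w (u : nat -> 'cV[R[i]]_n.+1) : N.-primitive_root w ->
  \sum_(i < N) defect (\sum_(k < N) w ^+ (i * k) *: u k)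
    = N%:R * \sum_(k < N) defect (u k).
Proof.
move=> prw; rewrite /defect !sumrB mulrBr parseval_enorm //.
rewrite -(parseval_enorm (fun k => T *m u k) prw).
by under [in X in _ - X = _]eq_bigr do
  (rewrite mulmx_sumr; under eq_bigr do rewrite -scalemxAr).
Qed.

(** The inequality with its boundary term: as [L] grows, the subtracted term
    tends to zero when [T] contracts strictly. *)
Lemma von_neumann_defect (p : {poly R[i]}) M x L :
    (forall z, cmod z = 1 -> cmod p.[z] <= M) ->
  enorm (horner_mx T p *m x) ^+ 2 - enorm (T ^+ L *m (horner_mx T p *m x)) ^+ 2
    <= M ^+ 2 * enorm x ^+ 2.
Proof.
move=> pM; case: L => [|L].
  by rewrite mul1mx subrr mulr_ge0 ?sqr_ge0.
(* L.+1 indices at which g has not wrapped around, plus size p for the largest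
   shift used by p. *)
set N := (L.+1 + size p)%N; have [w prw] := @prim_root_exists R N isT.
have wN := prim_expr_order prw; have w1 := cmod_unity_root (N := N) isT wN.
have w0 : w != 0.
  by apply: contra_eq_neq w1 => ->; rewrite cmod0 eq_sym oner_eq0.
have M0 : 0 <= M by apply: le_trans (pM 1 (cmod1 R)); exact: cmod_ge0.
pose u k := T ^+ (k %% N) *m x.
have uN k : u (k + N)%N = u k by rewrite /u modnDr.
pose g k := \sum_(m < size p) p`_m *: u (k + m)%N.
have gE k : (k < L.+1)%N -> g k = T ^+ k *m (horner_mx T p *m x).
  move=> kL; rewrite horner_mx_sum mulmx_suml mulmx_sumr; apply: eq_bigr => m _.
  rewrite -scalemxAl -scalemxAr mulmxA -[T ^+ k *m _]/(_ * _) -exprD.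
  by rewrite /u modn_small // -addSn leq_add // ltnW.
(* Parseval twice: compare the Fourier coefficients of g and u one by one. *)
have le_g : \sum_(k < N) defect (g k) <= M ^+ 2 * \sum_(k < N) defect (u k).
  have N0 : (0 : R) < N%:R by rewrite ltr0n.
  rewrite -(ler_pM2l N0) mulrCA -!(parseval_defect _ prw) mulr_sumr.
  apply: ler_sum => i _; rewrite dft_filter // defectZ ler_wpM2r ?defect_ge0 //.
  rewrite ler_pXn2r ?nnegrE ?cmod_ge0 // pM //.
  by apply: (cmod_unity_root (N := N)) => //; rewrite exprVn exprAC wN expr1n invr1.
have uE : \sum_(k < N) defect (u k) <= enorm x ^+ 2.
  under eq_bigr do rewrite /u modn_small //.
  by rewrite sum_defect_orbit gerBl sqr_ge0.
rewrite -sum_defect_orbit; apply: le_trans (ler_wpM2l (sqr_ge0 M) uE).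
apply: le_trans le_g; rewrite /N big_split_ord /=.
under eq_bigr => k _ do rewrite -gE //.
by rewrite lerDl sumr_ge0 // => k _; exact: defect_ge0.
Qed.

End Contraction.

(** Strictness gives [|T^k y| <= q^k |y|], which tends to [0], so the boundary
    term of [von_neumann_defect] disappears in the limit. *)
Lemma von_neumann_strict n (T : 'M[R[i]]_n.+1) q p M (x : 'cV_n.+1) :
    0 <= q < 1 -> (forall y : 'cV_n.+1, enorm (T *m y) <= q * enorm y) ->
    (forall z, cmod z = 1 -> cmod p.[z] <= M) ->
  enorm (horner_mx T p *m x) <= M * enorm x.
Proof.
move=> /andP[q0 q1] Tq pM.
have M0 : 0 <= M by apply: le_trans (pM 1 (cmod1 R)); exact: cmod_ge0.
have T1 y : enorm (T *m y) <= enorm y.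
  by apply: le_trans (Tq y) _; rewrite ler_piMl ?enorm_ge0 // ltW.
set y := horner_mx T p *m x.
have Tk k : enorm (T ^+ k *m y) <= q ^+ k * enorm y.
  elim: k => [|k IH]; first by rewrite mul1mx mul1r.
  rewrite exprS -[T * _]/(T *m _) -mulmxA; apply: le_trans (Tq _) _.
  by rewrite exprS -mulrA ler_wpM2l.
rewrite -(@ler_pXn2r _ 2) ?nnegrE ?mulr_ge0 ?enorm_ge0 // exprMn.
have cv : (fun k => enorm y ^+ 2 - (q ^+ k) * (q ^+ k * enorm y ^+ 2)) @ \oo
    --> enorm y ^+ 2 - 0 * (0 * enorm y ^+ 2).
  have qk : (fun k => q ^+ k) @ \oo --> (0 : R).
    by apply: cvg_expr; rewrite ger0_norm.
  by apply: cvgB; [exact: cvg_cst|apply: cvgM => //; apply: cvgMl].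
rewrite mul0r subr0 in cv.
apply: (ler_cvg_to cv (cvg_cst _)); apply: nearW => k.
apply: le_trans (von_neumann_defect T1 x k pM); rewrite lerB //.
by rewrite mulrA -expr2 -exprMn ler_pXn2r ?nnegrE ?mulr_ge0 ?exprn_ge0 ?enorm_ge0.
Qed.

End VonNeumann.

(** * The operator norm *)

Section OperatorNorm.
Local Open Scope classical_set_scope.
Local Open Scope ring_scope.
Variable R : realType.

Section Basics.
Variable n : nat.
Implicit Types A : 'M[R[i]]_n.

(** On the unit ball every coordinate has modulus at most [1], so the vector of
    row sums of the moduli of the entries bounds [A x]. *)
Lemma has_sup_opnorm A :
  has_sup [set enorm (A *m x) | x in [set x : 'cV[R[i]]_n | enorm x <= 1]].
Proof.
split.
  by exists (enorm (A *m 0)), 0 => //=; rewrite enorm0.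
exists (Num.sqrt (\sum_i (\sum_k cmod (A i k)) ^+ 2)) => _ [x /= x1 <-].
apply: ler_wsqrtr; apply: ler_sum => i _.
rewrite ler_pXn2r ?nnegrE ?cmod_ge0 ?sumr_ge0 // => [|k _]; last exact: cmod_ge0.
rewrite mxE; apply: le_trans (ler_cmod_sum _ _) _; apply: ler_sum => k _.
rewrite cmodM ler_piMr ?cmod_ge0 // -(@ler_pXn2r _ 2) ?nnegrE ?cmod_ge0 //.
have : enorm x ^+ 2 <= 1 ^+ 2 by rewrite ler_pXn2r ?nnegrE ?enorm_ge0.
apply: le_trans; rewrite sqr_enorm (bigD1 k) //= lerDl.
by apply: sumr_ge0 => j _; exact: sqr_ge0.
Qed.

Lemma opnorm_le A M :
  (forall x : 'cV_n, enorm x <= 1 -> enorm (A *m x) <= M) -> opnorm A <= M.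
Proof.
move=> AM; apply: ge_sup; first by case: (has_sup_opnorm A).
by move=> _ [x /= x1 <-]; exact: AM.
Qed.

Lemma opnorm_ge0 A : 0 <= opnorm A.
Proof.
have [[y Ay] ub] := has_sup_opnorm A.
by apply: le_trans (ub_le_sup ub Ay); case: Ay => x _ <-; exact: enorm_ge0.
Qed.

Lemma enorm_mulmx_le A (x : 'cV_n) : enorm (A *m x) <= opnorm A * enorm x.
Proof.
have [x0|x0] := eqVneq (enorm x) 0.
  by rewrite (enorm_eq0 x0) mulmx0 enorm0 mulr0.
have xgt0 : 0 < enorm x by rewrite lt_def x0 enorm_ge0.
have c0 : 0 <= (enorm x)^-1 by rewrite invr_ge0 enorm_ge0.
rewrite -ler_pdivrMr // mulrC -{1}(cmod_real c0) -enormZ scalemxAr.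
have [_ ub] := has_sup_opnorm A.
apply: (ub_le_sup ub); exists ((enorm x)^-1%:C *: x) => //=.
by rewrite enormZ cmod_real // mulVf.
Qed.

End Basics.

(** [A / r] is a strict contraction and [p(A) = q(A / r)] for [q(z) = p(r z)],
    so the strict case applies to [q] on the unit circle. *)
Lemma von_neumann n (A : 'M[R[i]]_n.+1) (p : {poly R[i]}) r M :
    opnorm A < r -> (forall z, cmod z = r -> cmod p.[z] <= M) ->
  opnorm (horner_mx A p) <= M.
Proof.
move=> Ar pM; have r0 : 0 < r by apply: le_lt_trans (opnorm_ge0 A) Ar.
pose T := (r^-1)%:C *: A; pose q := p \Po (r%:C *: 'X).
have qT : horner_mx T q = horner_mx A p.
  rewrite [RHS]horner_mx_sum /q comp_polyE rmorph_sum; apply: eq_bigr => m _ /=.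
  rewrite horner_mxZ rmorphXn /= horner_mxZ horner_mx_X scalerA.
  by rewrite -rmorphM /= divff ?scale1r // gt_eqF.
have M0 : 0 <= M.
  by apply: le_trans (pM r%:C (cmod_real (ltW r0))); exact: cmod_ge0.
apply: opnorm_le => x x1; rewrite -qT.
apply: (@le_trans _ _ (M * enorm x)); last by rewrite ler_piMr.
apply: (@von_neumann_strict _ _ _ (opnorm A / r)) => [|y|z z1].
- by rewrite divr_ge0 ?opnorm_ge0 ?(ltW r0) //= ltr_pdivrMr // mul1r.
- rewrite -scalemxAl enormZ cmod_real ?invr_ge0 ?(ltW r0) // mulrC mulrAC.
  by rewrite ler_wpM2r ?invr_ge0 ?(ltW r0) // enorm_mulmx_le.
- rewrite horner_comp !hornerE pM // cmodM z1 mulr1 cmod_real //.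
  exact: ltW.
Qed.

(** Continuity of the majorant [M] allows the radius [r > |A|] to decrease to
    [|A|]; this avoids the maximum modulus principle. *)
Lemma von_neumann_growth n (A : 'M[R[i]]_n.+1) (p : {poly R[i]}) (M : R -> R) :
    {for opnorm A, continuous M} -> (forall z, cmod p.[z] <= M (cmod z)) ->
  opnorm (horner_mx A p) <= M (opnorm A).
Proof.
move=> Mc pM.
have Mr : M x @[x --> (opnorm A)^'+] --> M (opnorm A).
  exact: cvg_at_right_filter.
apply: (ler_cvg_to (cvg_cst _) Mr); near=> r.
by apply: (@von_neumann _ _ _ r) => [|z <-] //; near: r; exact: nbhs_right_gt.
Unshelve. all: by end_near. Qed.

End OperatorNorm.

(** * Scalar estimates *)

Section ScalarBounds.
Variable R : realType.

(** The coefficient of degree two is doubled to express it by power sums,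
    without a sum over pairs of indices. *)
Lemma coef_prod_linear (F : comNzRingType) (I : Type) (s : seq I) (b : I -> F) :
  let p := \prod_(j <- s) (1 + b j *: 'X) in
  [/\ p`_0 = 1, p`_1 = \sum_(j <- s) b j
    & p`_2 *+ 2 = (\sum_(j <- s) b j) ^+ 2 - \sum_(j <- s) b j ^+ 2].
Proof.
elim: s => [|j s [p0 p1 p2]] /=; rewrite ?big_nil ?big_cons.
  by rewrite !coef1 mul0rn expr0n subrr.
set p := \prod_(i <- s) _ in p0 p1 p2 *.
have pE k : ((1 + b j *: 'X) * p)`_k = p`_k + b j * (if k is k'.+1 then p`_k' else 0).
  rewrite mulrDl mul1r coefD -scalerAl coefZ coefXM.
  by case: k.
rewrite !pE p0 p1 mulr0 addr0 mulr1 mulrnDl p2; split=> //; first by rewrite addrC.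
by ring.
Qed.

Lemma Re_sum (I : Type) (s : seq I) (F : I -> R[i]) :
  complex.Re (\sum_(j <- s) F j) = \sum_(j <- s) complex.Re (F j).
Proof. by apply: (big_morph (@complex.Re R)) => [[? ?] [? ?]|]. Qed.

Lemma Im_sum (I : Type) (s : seq I) (F : I -> R[i]) :
  complex.Im (\sum_(j <- s) F j) = \sum_(j <- s) complex.Im (F j).
Proof. by apply: (big_morph (@complex.Im R)) => [[? ?] [? ?]|]. Qed.

Lemma var_sum d (x : 'I_d -> R) : (0 < d)%N ->
  d%:R * var x = \sum_(j < d) x j ^+ 2 - d%:R * mean x ^+ 2.
Proof.
move=> d0; have dn0 : d%:R != 0 :> R by rewrite pnatr_eq0 -lt0n.
have sE : \sum_(j < d) x j = d%:R * mean x by rewrite mulVKf.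
rewrite /var mulVKf //; under eq_bigr do rewrite sqrrB.
rewrite big_split sumrB /= sumr_const card_ord sumrMnl -mulr_suml sE.
by rewrite -mulr_natl; ring.
Qed.

(** Cauchy-Schwarz against the constant family; the gap between the two sides is
    [d^2] times the variance. *)
Lemma sqr_sum_le d (x : 'I_d -> R) : (0 < d)%N ->
  (\sum_(j < d) x j) ^+ 2 <= d%:R * \sum_(j < d) x j ^+ 2.
Proof.
move=> d0; have dn0 : d%:R != 0 :> R by rewrite pnatr_eq0 -lt0n.
have -> : \sum_(j < d) x j = d%:R * mean x by rewrite mulVKf.
rewrite exprMn expr2 -mulrA ler_wpM2l ?ler0n // -subr_ge0 -var_sum //.
by rewrite mulVKf // sumr_ge0 // => j _; exact: sqr_ge0.
Qed.

Lemma horner_prod_linear d (b : 'I_d -> R[i]) z :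
  (\prod_(j < d) (1 + b j *: 'X)).[z] = \prod_(j < d) (1 + b j * z).
Proof. by rewrite horner_prod; apply: eq_bigr => j _; rewrite !hornerE. Qed.

Lemma cmod_prod (I : Type) (s : seq I) (F : I -> R[i]) :
  cmod (\prod_(j <- s) F j) = \prod_(j <- s) cmod (F j).
Proof. by apply: big_morph; [exact: cmodM|exact: cmod1]. Qed.

Lemma cmod_prod_linear_le d (b : 'I_d -> R[i]) z :
  cmod (\prod_(j < d) (1 + b j *: 'X)).[z]
    <= expR (cmod z * \sum_(j < d) cmod (b j)).
Proof.
rewrite horner_prod_linear cmod_prod mulr_sumr expR_sum.
apply: ler_prod => j _; rewrite cmod_ge0 /=.
apply: le_trans (ler_cmodD _ _) _.
by rewrite cmod1 cmodM mulrC expR_ge1Dx.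
Qed.

(** Squaring both sides, this is [1 + t <= exp t] at
    [t = 2 Re w + |w|^2 = |1 + w|^2 - 1]. *)
Lemma cmod_1D_le (w : R[i]) :
  cmod (1 + w) <= expR (complex.Re w + 2^-1 * cmod w ^+ 2).
Proof.
rewrite -(@ler_pXn2r _ 2) ?nnegrE ?cmod_ge0 ?expR_ge0 //.
rewrite -expRM_natl; apply: le_trans (expR_ge1Dx _).
rewrite !sqr_cmod; case: w => x y /=.
by rewrite le_eqVlt; apply/orP; left; apply/eqP; field.
Qed.

(** The bound [cmod_1D_le] keeps the real parts [Re (b_j z)] with their sign, so
    they add up to [Re (a_1 z)] before the modulus is taken. *)
Lemma cmod_prod_linear_le_quad d (b : 'I_d -> R[i]) z :
  cmod (\prod_(j < d) (1 + b j *: 'X)).[z]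
    <= expR (cmod (\sum_(j < d) b j) * cmod z
             + 2^-1 * (\sum_(j < d) cmod (b j) ^+ 2) * cmod z ^+ 2).
Proof.
rewrite horner_prod_linear cmod_prod.
apply: (@le_trans _ _
  (\prod_(j < d) expR (complex.Re (b j * z) + 2^-1 * cmod (b j * z) ^+ 2))).
  by apply: ler_prod => j _; rewrite cmod_ge0 cmod_1D_le.
rewrite -expR_sum ler_expR big_split /= -Re_sum -mulr_suml -cmodM.
apply: lerD; first exact: ler_Re_cmod.
rewrite -mulr_sumr -mulrA mulr_suml.
by under eq_bigr do rewrite cmodM exprMn.
Qed.

(** Writing [b_j = x_j + i y_j], the right-hand side is
    [2 (sum y_j)^2 + sum x_j^2 - sum y_j^2], and the variance hypothesis amounts
    to [sum y_j^2 <= (sum y_j)^2]. *)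
Lemma sum_cmod_sqr_le d (b : 'I_d -> R[i]) (p : {poly R[i]}) : (0 < d)%N ->
    p = \prod_(j < d) (1 + b j *: 'X) ->
    var (fun j => complex.Im (b j))
      <= (d%:R - 1) * mean (fun j => complex.Im (b j)) ^+ 2 ->
  \sum_(j < d) cmod (b j) ^+ 2 <= cmod p`_1 ^+ 2 - 2 * complex.Re p`_2.
Proof.
move=> d0 pE hv; have [_ p1 p2] := coef_prod_linear (index_enum 'I_d) b.
rewrite -pE in p1 p2.
have dgt0 : (0 : R) < d%:R by rewrite ltr0n.
have hs : \sum_(j < d) complex.Im (b j) ^+ 2 <= complex.Im p`_1 ^+ 2.
  have sE : complex.Im p`_1 = d%:R * mean (fun j => complex.Im (b j)).
    by rewrite p1 Im_sum mulVKf ?gt_eqF.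
  rewrite -(ler_pM2l dgt0) var_sum // in hv.
  by move: hv; rewrite sE; set m := mean _; set s := \sum_j _; nra.
have re2 : 2 * complex.Re p`_2 = complex.Re p`_1 ^+ 2 - complex.Im p`_1 ^+ 2
    - \sum_(j < d) (complex.Re (b j) ^+ 2 - complex.Im (b j) ^+ 2).
  have reX (z : R[i]) : complex.Re (z ^+ 2) = complex.Re z ^+ 2 - complex.Im z ^+ 2.
    by case: z => x y; rewrite !expr2.
  under eq_bigr do rewrite -reX.
  rewrite -Re_sum -reX p1 mulr_natl; move/(congr1 (@complex.Re R)): p2.
  set u := _ ^+ 2; set v := \sum_j _.
  by case: p`_2 u v => [? ?] [? ?] [? ?] /= <-; rewrite mulr2n.
under eq_bigr do rewrite sqr_cmod.
rewrite re2 sqr_cmod big_split sumrB /=; lra.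
Qed.

End ScalarBounds.

Theorem theorem6p3 (R : realType) (d : nat) (hd : (1 <= d)%N)
    (b : 'I_d -> R[i]) (p : {poly R[i]})
    (hpa : p = 1 + \sum_(1 <= j < d.+1) p`_j *: 'X^j)
    (hpb : p = \prod_(j < d) (1 + b j *: 'X))
    (hvar : var (fun j => complex.Im (b j))
            <= (d%:R - 1) * mean (fun j => complex.Im (b j)) ^+ 2)
    (n : nat) (A : 'M[R[i]]_n.+1) :
  [/\ opnorm (horner_mx A p)
        <= expR (opnorm A * \sum_(j < d) cmod (b j)),
      expR (opnorm A * \sum_(j < d) cmod (b j))
        <= expR (opnorm A * Num.sqrt
             (d%:R * (cmod p`_1 ^+ 2 - 2 * complex.Re p`_2))) &
      opnorm (horner_mx A p)
        <= expR (cmod p`_1 * opnorm A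
             + 2^-1 * (cmod p`_1 ^+ 2 - 2 * complex.Re p`_2)
               * opnorm A ^+ 2)].
Proof.
have le_Q := sum_cmod_sqr_le hd hpb hvar.
have [_ p1 _] := coef_prod_linear (index_enum 'I_d) b; rewrite -hpb in p1.
split.
- apply: (von_neumann_growth (M := fun r => expR (r * \sum_(j < d) cmod (b j)))).
    apply: continuous_comp; last exact: continuous_expR.
    by apply: cvgMl; exact: cvg_id.
  by move=> z; rewrite hpb cmod_prod_linear_le.
- rewrite ler_expR ler_wpM2l ?opnorm_ge0 //.
  have S0 : 0 <= \sum_(j < d) cmod (b j).
    by apply: sumr_ge0 => j _; exact: cmod_ge0.
  rewrite -[leLHS]ger0_norm // -sqrtr_sqr ler_wsqrtr //.
  apply: le_trans (sqr_sum_le _ hd) _.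
  by rewrite ler_wpM2l ?ler0n.
- apply: (von_neumann_growth (M := fun r => expR (cmod p`_1 * r
     + 2^-1 * (cmod p`_1 ^+ 2 - 2 * complex.Re p`_2) * r ^+ 2))).
    apply: continuous_comp; last exact: continuous_expR.
    by apply: cvgD; apply: cvgMr; [exact: cvg_id|rewrite expr2; apply: cvgM; exact: cvg_id].
  move=> z; rewrite [in X in cmod X]hpb.
  apply: le_trans (cmod_prod_linear_le_quad _ _) _.
  by rewrite ler_expR -p1 lerD2l ler_wpM2r ?sqr_ge0 // ler_wpM2l ?invr_ge0.
Qed.
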